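(* Let $d\in\mathbb{N}$, let $\Omega\subseteq\mathbb{R}^d$ be a compact convex subset with dense interior (for example $\Omega=[0,1]^d$), fix a norm on $\mathbb{R}^d$, and let $\mathcal{V}:=\operatorname{Diff}_\partial(\Omega)-\operatorname{id}_\Omega$. Then for all $L\in\mathbb{N}$ and all $f_1,\dots,f_L\in\mathcal{V}$ the following hold, where $\Phi:=((\operatorname{id}_\Omega+f_L)\circ\cdots\circ(\operatorname{id}_\Omega+f_1))-\operatorname{id}_\Omega$: (a) For $k\in\{0,1\}$, $$\|\Phi\|_{C^k}\leq e^{k\sum_{j=1}^L\|f_j\|_{C^k}}\,(\|f_1\|_{C^k}+\cdots+\|f_L\|_{C^k}).$$ (b) $\|\Phi\|_\infty\leq\|f_1\|_\infty+\cdots+\|f_L\|_\infty$. (c) $$\begin{aligned}\operatorname{Lip}(\Phi)&\leq(1+\operatorname{Lip}(f_1))\cdots(1+\operatorname{Lip}(f_L))-1\\&\leq e^{\operatorname{Lip}(f_1)+\cdots+\operatorname{Lip}(f_L)}-1\\&\leq e^{\operatorname{Lip}(f_1)+\cdots+\operatorname{Lip}(f_L)}\,(\operatorname{Lip}(f_1)+\cdots+\operatorname{Lip}(f_L)).\end{aligned}$$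
   Context: $\Omega\subseteq\mathbb{R}^d$ has dense interior if the interior $\Omega^\circ$ is dense in $\Omega$. A map on $\Omega$ is smooth ($C^\infty$) if it extends to a smooth map on an open subset of $\mathbb{R}^d$ containing $\Omega$. $\operatorname{Diff}(\Omega)$ is the group of all $C^\infty$-diffeomorphisms of $\Omega$ (bijections of $\Omega$, smooth with smooth inverse), and $$\operatorname{Diff}_\partial(\Omega):=\{\phi\in\operatorname{Diff}(\Omega) : \phi(k)=k\ \text{for all } k\in\partial\Omega\},$$ with $\partial\Omega$ the topological boundary. $\operatorname{Diff}_\partial(\Omega)-\operatorname{id}_\Omega:=\{\phi-\operatorname{id}_\Omega : \phi\in\operatorname{Diff}_\partial(\Omega)\}$; its elements are smooth maps $\Omega\to\mathbb{R}^d$ vanishing on $\partial\Omega$. For a smooth map $f\colon\Omega\to\mathbb{R}^d$, put $\|f\|_\infty:=\sup_{x\in\Omega}\|f(x)\|$, $\|f\|_{C^0}:=\|f\|_\infty$, and $\|f\|_{C^1}:=\max\{\|f\|_\infty,\ \sup_{x\in\Omega}\|f'(x)\|_{\mathrm{op}}\}$, where $f'(x)$ is the derivative (extended continuously from $\Omega^\circ$ to $\Omega$) and $\|\cdot\|_{\mathrm{op}}$ is the operator norm with respect to the fixed norm on $\mathbb{R}^d$. $\operatorname{Lip}(f)$ denotes the (smallest) Lipschitz constant of $f$ with respect to the fixed norm. *)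

(* Defs.v *)
From HB Require Import structures.
From mathcomp Require Import all_boot all_order all_algebra.
From mathcomp Require Import all_classical all_reals all_analysis.

Set Implicit Arguments.
Unset Strict Implicit.
Unset Printing Implicit Defensive.

Import Order.TTheory GRing.Theory Num.Theory.
Import numFieldNormedType.Exports.

Local Open Scope classical_set_scope.
Local Open Scope ring_scope.

(* A map on a set [Omega] is represented by a total function on the whole
   space; every notion below depends only on its values on [Omega]. *)

(* [C^k] maps on an open set [U]. *)
Fixpoint Ck_on (R : realType) (V W : normedModType R) (k : nat) (U : set V)
    (f : V -> W) : Prop :=
  match k with
  | 0 => forall x, U x -> {for x, continuous f}
  | k'.+1 => (forall x, U x -> differentiable f x) /\
             (forall v : V, Ck_on k' U (fun x => 'D_v f x))
  end.

Definition smooth_on (R : realType) (V W : normedModType R) (Omega : set V)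
    (f : V -> W) : Prop :=
  exists (U : set V) (g : V -> W),
    [/\ open U, Omega `<=` U, forall k, Ck_on k U g &
        forall x, Omega x -> f x = g x].

Definition dense_interior (T : topologicalType) (A : set T) : Prop :=
  A `<=` closure A°.

Definition boundary (T : topologicalType) (A : set T) : set T :=
  closure A `\` A°.

Definition Diff (R : realType) (V : normedModType R) (Omega : set V) :
    set (V -> V) :=
  [set phi | [/\ set_bij Omega Omega phi, smooth_on Omega phi &
     exists2 psi, smooth_on Omega psi &
       forall x, Omega x -> psi (phi x) = x]].

Definition Diff_boundary (R : realType) (V : normedModType R) (Omega : set V) :
    set (V -> V) :=
  [set phi | Diff Omega phi /\ forall x, boundary Omega x -> phi x = x].

Definition Diff_boundary_sub_id (R : realType) (V : normedModType R)
    (Omega : set V) : set (V -> V) :=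
  [set f | exists2 phi, Diff_boundary Omega phi &
     forall x, Omega x -> f x = phi x - x].

Definition is_norm (R : realType) (V : lmodType R) (N : V -> R) : Prop :=
  [/\ forall x y, N (x + y) <= N x + N y,
      forall (a : R) x, N (a *: x) = `|a| * N x &
      forall x, N x = 0 -> x = 0].

(* Suprema and infima below are taken in [R], with [sup set0 = inf set0 = 0].
   On a compact convex [Omega] with dense interior and for smooth maps, the
   sets in question are bounded, and the set of Lipschitz constants is
   nonempty. *)

Definition op_norm (R : realType) (V : lmodType R) (N : V -> R) (A : V -> V) :
    R :=
  sup [set N (A v) | v in [set v | N v <= 1]].

(* The derivative at a point [x] of [Omega], extended continuously from the
   interior of [Omega]. *)
Definition deriv_on (R : realType) (V : normedModType R) (Omega : set V)
    (f : V -> V) (x : V) : V -> V :=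
  fun v => lim ('d f y v @[y --> within Omega° (nbhs x)]).

Definition sup_norm (R : realType) (V : normedModType R) (N : V -> R)
    (Omega : set V) (f : V -> V) : R :=
  sup [set N (f x) | x in Omega].

(* The [C^k]-norm, to be used for [k = 0] and [k = 1] only. *)
Definition Ck_norm (R : realType) (V : normedModType R) (N : V -> R)
    (Omega : set V) (k : nat) (f : V -> V) : R :=
  if k is 0 then sup_norm N Omega f
  else Num.max (sup_norm N Omega f)
         (sup [set op_norm N (deriv_on Omega f x) | x in Omega]).

Definition Lip (R : realType) (V : normedModType R) (N : V -> R)
    (Omega : set V) (f : V -> V) : R :=
  inf [set K | 0 <= K /\
    forall x y, Omega x -> Omega y -> N (f x - f y) <= K * N (x - y)].

(* [g_(L-1) \o ... \o g_0], the map with the smallest index acting first. *)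
Definition compose_all (T : Type) (L : nat) (g : 'I_L -> T -> T) : T -> T :=
  \big[(fun u v => u \o v)/idfun]_(j < L) g (rev_ord j).

(* Main.v *)
Require Import Defs.
From HB Require Import structures.
From mathcomp Require Import all_boot all_order all_algebra.
From mathcomp Require Import all_classical all_reals all_analysis.
From mathcomp Require Import lra.
Import Order.TTheory GRing.Theory Num.Theory.
Import numFieldNormedType.Exports.
Local Open Scope classical_set_scope.
Local Open Scope ring_scope.

(** Writing Phi_n for the partial compositions minus the identity, one has
    Phi_{n+1} = Phi_n + f_{n+1} \o (id + Phi_n); this gives (b) and the recursion
    1 + Lip Phi_{n+1} <= (1 + Lip Phi_n) (1 + Lip f_{n+1}), hence (c). The C^1
    bound reduces to (c): the derivative of Phi has operator norm at most
    Lip Phi, while Lip f_j is at most the supremum of the operator norms of the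
    derivative of f_j by the mean value inequality on the convex set Omega.
    This way neither the chain rule nor the smoothness of Phi is needed. *)

Set Implicit Arguments.
Unset Strict Implicit.

(** * Norms on ['rV[R]_d] and the mean value inequality *)

Lemma is_norm0 (R : realType) (V : lmodType R) (N : V -> R) :
  is_norm N -> N 0 = 0.
Proof. by case=> _ NZ _; rewrite -(scale0r 0) NZ normr0 mul0r. Qed.

Lemma is_normN (R : realType) (V : lmodType R) (N : V -> R) (v : V) :
  is_norm N -> N (- v) = N v.
Proof. by case=> _ NZ _; rewrite -scaleN1r NZ normrN1 mul1r. Qed.

Lemma is_norm_ge0 (R : realType) (V : lmodType R) (N : V -> R) (v : V) :
  is_norm N -> 0 <= N v.
Proof.
move=> hN; have [ND _ _] := hN.
have := ND v (- v); rewrite subrr is_norm0// is_normN//; lra.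
Qed.

Lemma is_norm_sum (R : realType) (V : lmodType R) (N : V -> R) (I : Type)
    (s : seq I) (F : I -> V) :
  is_norm N -> N (\sum_(i <- s) F i) <= \sum_(i <- s) N (F i).
Proof.
move=> hN; have [ND _ _] := hN.
elim: s => [|i s IHs]; first by rewrite !big_nil is_norm0.
by rewrite !big_cons; apply: (le_trans (ND _ _)); rewrite lerD2l.
Qed.

Lemma coord_le_norm (R : realType) (d : nat) (v : 'rV[R]_d) (i : 'I_d) :
  `|v 0 i| <= `|v|.
Proof.
rewrite [leRHS]/Num.Def.normr /= mx_normrE.
exact: (le_bigmax 0 (fun ij => `|v ij.1 ij.2|) (0, i)).
Qed.

(** Expand [v] in the unit row vectors and bound each coordinate by the max norm. The identity gives
    the continuity of [N]; differentials give bounds uniform over [Omega]. *)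
Lemma norm_linear_le (R : realType) (d : nat) (N : 'rV[R]_d -> R)
    (A : {linear 'rV[R]_d -> 'rV[R]_d}) (v : 'rV[R]_d) :
  is_norm N -> N (A v) <= (\sum_i N (A 'e_i)) * `|v|.
Proof.
move=> hN; have [_ NZ _] := hN.
rewrite [v in N (A v)]row_sum_delta linear_sum mulr_suml.
apply: (le_trans (is_norm_sum _ _ hN)); apply: ler_sum => i _.
by rewrite linearZ NZ mulrC ler_wpM2l ?is_norm_ge0// coord_le_norm.
Qed.

Lemma is_norm_continuous (R : realType) (d : nat) (N : 'rV[R]_d -> R) :
  is_norm N -> continuous N.
Proof.
move=> hN x; have [ND _ _] := hN.
pose C : R := \sum_i N 'e_i.
have NC v : N v <= C * `|v| := norm_linear_le idfun v hN.
have C0 : 0 <= C by apply: sumr_ge0 => i _; exact: is_norm_ge0.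
have Fx : Filter (nbhs x) := nbhs_filter x.
apply/cvgrPdist_le => /= e e0.
(* The [+ 1] keeps the divisor positive when [C = 0], as happens for [d = 0]. *)
have e1 : 0 < e / (C + 1) by rewrite divr_gt0//; lra.
apply: filterS (nbhsx_ballx x _ e1) => y.
rewrite -ball_normE /ball_/= ltr_pdivlMr; last lra.
move=> xy; have {xy} Nxy : N (x - y) <= e.
  by apply: (le_trans (NC _)); have := normr_ge0 (x - y); lra.
have := ND (x - y) y; have := ND (y - x) x.
rewrite !subrK -(opprB x y) is_normN// ler_norml => h1 h2.
by apply/andP; split; lra.
Qed.

(** [N] attains a minimum on the compact unit sphere of the max norm, positive by definiteness; its
    inverse is the constant, by homogeneity. *)
Lemma norm_le_is_norm (R : realType) (d : nat) (N : 'rV[R]_d -> R) :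
  is_norm N -> exists2 C, 0 <= C & forall v, `|v| <= C * N v.
Proof.
move=> hN; have [_ NZ N0] := hN.
pose S : set 'rV[R]_d := [set v | `|v| = 1].
have SE : S = (@Num.Def.normr R 'rV[R]_d) @^-1` [set 1] by [].
have cS : compact S.
  apply: bounded_closed_compact.
    exists 1; split; first exact: num_real.
    by move=> M M1 v /= ->; exact: ltW.
  rewrite SE; apply: preimage_closed; last exact: closed_eq.
  by move=> w _; exact: (@norm_continuous R ('rV[R]_d : normedModType R) w).
have toS v : v != 0 -> S (`|v|^-1 *: v).
  by move=> v0; rewrite /S/= normrZ normfV normr_id mulVf// normr_eq0.
(* The sphere is empty when [d = 0], and then every vector is 0. *)
have [[w Sw]|S0] := pselect (S !=set0); last first.
  exists 0 => // v; have [->|v0] := eqVneq v 0; first by rewrite normr0 mul0r.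
  by exfalso; apply: S0; exists (`|v|^-1 *: v); exact: toS.
have [c cS1 cmin] := EVT_min_rV (ex_intro _ w Sw) cS
  (continuous_subspaceT (is_norm_continuous hN)).
have Nc : 0 < N c.
  rewrite lt_neqAle is_norm_ge0// andbT eq_sym; apply/eqP => /N0 c0.
  by move: cS1; rewrite inE /S /= c0 normr0 => /eqP; rewrite eq_sym oner_eq0.
exists (N c)^-1; first by rewrite invr_ge0 ltW.
move=> v; have [->|v0] := eqVneq v 0; first by rewrite normr0 is_norm0// mulr0.
have := cmin (`|v|^-1 *: v); rewrite inE => /(_ (toS _ v0)).
rewrite NZ normfV normr_id [leLHS](_ : _ = `|v|^-1 * (`|v| * N c)); last first.
  by rewrite mulKf// normr_eq0.
by rewrite ler_pM2l ?invr_gt0 ?normr_gt0// ler_pdivlMl// mulrC.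
Qed.

(* The set of [t] with [N (h t - h 0) <= (K + e) * t] contains its supremum,
   and the supremum cannot be less than 1; no duality is needed for [N]. *)
Lemma mean_value_inequality (R : realType) (d : nat) (N : 'rV[R]_d -> R)
    (h : R -> 'rV[R]_d) (K : R) :
  is_norm N ->
  (forall t, 0 <= t <= 1 -> derivable h t 1 /\ N ('D_1 h t) <= K) ->
  N (h 1 - h 0) <= K.
Proof.
move=> hN hd; have [ND NZ _] := hN.
(* The slack [e] makes the bound on [N ('D_1 h t)] strict, so that it persists for difference
   quotients near [t]. *)
apply/ler_addgt0Pr => e e0.
have K0 : 0 <= K.
  have [|_] := hd 0; first by rewrite lexx ler01.
  by apply: le_trans; exact: is_norm_ge0.
have slope t : 0 <= t <= 1 -> exists2 r, 0 < r & forall u, `|u - t| < r ->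
    N (h u - h t) <= (K + e) * `|u - t|.
  move=> /hd[dh DK].
  have : (fun s : R => N (s^-1 *: (h (s *: 1 + t) - h t))) @ 0^' -->
      N ('D_1 h t).
    apply: (@cvg_comp _ _ _ _ N _ _ _ dh).
    exact: is_norm_continuous.
  move=> /cvgr_le/(_ (K + e)).
  have DKe : N ('D_1 h t) < K + e by rewrite (le_lt_trans DK)// ltrDl.
  move=> /(_ DKe) [r /= r0 hr]; exists r => // u ur.
  have [->|ut] := eqVneq u t.
    by rewrite !subrr is_norm0// normr0 mulr0.
  have ut0 : u - t != 0 by rewrite subr_eq0.
  have := hr (u - t); rewrite /= sub0r normrN => /(_ ur ut0).
  have -> : (u - t) *: (1 : R) = u - t by rewrite /GRing.scale /= mulr1.
  by rewrite subrK NZ normfV ler_pdivrMl ?normr_gt0// mulrC.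
pose A : set R := [set t | 0 <= t <= 1 /\ N (h t - h 0) <= (K + e) * t].
have A0 : A 0 by split; rewrite ?lexx ?ler01// subrr is_norm0// mulr0.
have supA : has_sup A by split; [exists 0|exists 1 => t [/andP[]]].
set c := sup A.
have c01 : 0 <= c <= 1.
  apply/andP; split; first exact: sup_upper_bound.
  by apply: ge_sup; [exists 0|move=> t [/andP[]]].
have step u v : N (h u - h v) <= (K + e) * `|u - v| -> v <= u ->
    N (h v - h 0) <= (K + e) * v -> N (h u - h 0) <= (K + e) * u.
  move=> huv vu hv; rewrite ger0_norm in huv; last lra.
  have := ND (h u - h v) (h v - h 0).
  rewrite addrA subrK; nra.
have [r r0 hr] := slope c c01.
have Ac : A c.
  split=> //; have [a [a01 Aa] ca] := sup_adherent r0 supA.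
  have ac : a <= c by apply: sup_upper_bound.
  apply: (step _ a) => //.
  rewrite -opprB is_normN// -(distrC a c); apply: hr.
  by rewrite distrC ger0_norm; [rewrite /c in ac *; lra|lra].
have [c1|c1] := ltP c 1; last first.
  have -> : 1 = c by lra.
  by case: Ac => _ /le_trans; apply; rewrite -[leRHS]mulr1 ler_wpM2l//; lra.
(* [r / 2] keeps [c + s] within the radius of [slope] at [c], and [1 - c] keeps it in the unit
   interval. *)
pose s := Num.min (r / 2) (1 - c).
have s0 : 0 < s by rewrite /s lt_min; apply/andP; split; lra.
have sr : s < r by rewrite /s gt_min; apply/orP; left; lra.
have s1 : s <= 1 - c by rewrite /s ge_min lexx orbT.
have : A (c + s).
  split; first by apply/andP; split; lra.
  apply: (step _ c); [apply: hr|lra|by case: Ac].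
  by rewrite addrC addKr gtr0_norm.
by move=> /(sup_upper_bound supA); rewrite -/c; lra.
Qed.

(** * Differentials and their continuous extension from the interior *)

(** The first-order expansion determines the differential and depends only on the germ at [x]. This
    passes from [f], arbitrary outside [Omega], to a differentiable extension at interior points. *)
Lemma near_eq_diff (R : realType) (V W : normedModType R) (f g : V -> W)
    (x : V) :
  (\near x, f x = g x) -> differentiable g x -> 'd f x = 'd g x :> (V -> W).
Proof.
move=> fg dg; apply: diff_unique; first exact: diff_continuous.
have fgx : f x = g x := nbhs_singleton fg.
rewrite fgx; apply/eqaddoP => e e0.
have /eqaddoP /(_ e e0) := diff_locally dg.
apply: filter_app.
have : \forall h \near (0 : V), f (h + x) = g (h + x).
  by rewrite (near_shift x) /= sub0r; near=> y; rewrite /= subrK; near: y.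
apply: filterS => h /=.
by rewrite !fctE /= => ->.
Unshelve. all: by end_near. Qed.

(** [smooth_on] restricted to order 1, the regularity at which the estimates for a single map are
    made. *)
Definition C1_on (R : realType) (V W : normedModType R) (Omega : set V)
    (f : V -> W) : Prop :=
  exists (U : set V) (g : V -> W), [/\ open U, Omega `<=` U, Ck_on 1 U g &
    forall x, Omega x -> f x = g x].

(** At interior points [f] and its extension [g] have the same differential; continuity of the
    directional derivatives of [g] identifies the limit. Density of the interior makes the limit
    filter proper. *)
Lemma C1_on_deriv (R : realType) (V : normedModType R)
    (Omega : set V) (f : V -> V) :
  dense_interior Omega -> C1_on Omega f ->
  exists g : V -> V, [/\ forall x, Omega x -> f x = g x,
    forall x, Omega x -> differentiable g x,
    forall x v, Omega x -> {for x, continuous (fun y => 'd g y v)} &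
    forall x, Omega x -> deriv_on Omega f x = 'd g x].
Proof.
move=> dO [U [g [oU OU Ckg fg]]]; exists g.
have [dg cg] := Ckg.
have cdg x v : Omega x -> {for x, continuous (fun y => 'd g y v)}.
  move=> Ox; have UxE : \forall y \near x, 'D_v g y = 'd g y v.
    apply: filterS (open_nbhs_nbhs (conj oU (OU _ Ox))) => y Uy.
    by rewrite deriveE//; exact: dg.
  rewrite /prop_for /continuous_at -(nbhs_singleton UxE).
  apply: cvg_trans (cg v x (OU _ Ox)).
  by apply: near_eq_cvg; apply: filterS UxE => y.
split=> // [x Ox|x Ox]; first exact/dg/OU.
apply/funext => v; rewrite /deriv_on.
have PF : ProperFilter (within Omega° (nbhs x)).
  by apply: within_nbhs_proper; exact: dO.
apply: cvg_lim => //.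
have : 'd g y v @[y --> within Omega° (nbhs x)] --> 'd g x v.
  by apply: cvg_within_filter; exact: cdg.
apply: cvg_trans; apply: near_eq_cvg.
rewrite near_withinE; apply: nearW => y Oy.
rewrite (@near_eq_diff _ _ _ f g y)//.
  by apply: filterS (Oy) => z; exact: fg.
by apply/dg/OU; exact: interior_subset.
Qed.

(* No convergence is assumed: the limit of a divergent filter is [point = 0]. *)
Lemma norm_lim_le (R : realType) (d : nat) (N : 'rV[R]_d -> R) (T : Type)
    (F : set_system T) (FF : ProperFilter F) (u : T -> 'rV[R]_d) (K : R) :
  is_norm N -> (\forall t \near F, N (u t) <= K) -> N (lim (u @ F)) <= K.
Proof.
move=> hN uK; have [cu|ncu] := pselect (cvg (u @ F)).
  have Nu : (N (u t) @[t --> F]) --> N (lim (u @ F)).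
    apply: (@cvg_comp _ _ _ u N _ _ _ cu).
    exact: is_norm_continuous.
  exact: (closed_cvg (fun r => r <= K) (@closed_le _ K) uK _ Nu).
have -> : lim (u @ F) = 0.
  rewrite dvgP//; apply/matrixP => i j; rewrite !mxE; reflexivity.
have [t /=] := filter_ex uK.
by rewrite is_norm0//; apply: le_trans; exact: is_norm_ge0.
Qed.

(* No differentiability is assumed: otherwise ['d f x] is the default linear
   map, which is [0]. *)
Lemma norm_diff_le (R : realType) (d : nat) (N : 'rV[R]_d -> R)
    (f : 'rV[R]_d -> 'rV[R]_d) (x v : 'rV[R]_d) (K : R) :
  is_norm N -> 0 <= K -> (\forall y \near x, N (f y - f x) <= K * N (y - x)) ->
  N ('d f x v) <= K * N v.
Proof.
move=> hN K0 fK; have [_ NZ _] := hN.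
have [df|ndf] := pselect (differentiable f x); last first.
  have -> : 'd f x v = 0.
    rewrite /diff; set P := (X in get X).
    rewrite getPN// => A PA; apply: ndf; apply/diffP.
    exact: (@getPex _ P (ex_intro P A PA)).
  by rewrite is_norm0// mulr_ge0// is_norm_ge0.
rewrite -deriveE//; apply: norm_lim_le => //.
have : \forall h \near (0:R), N (f (h *: v + x) - f x) <= K * N (h *: v).
  have hv : h *: v + x @[h --> (0:R)] --> x.
    rewrite -[X in _ --> X]add0r -[X in X + _](scale0r v).
    by apply: cvgD; [apply: cvgZr_tmp; exact: cvg_id|exact: cvg_cst].
  have : \forall h \near (0:R),
      N (f (h *: v + x) - f x) <= K * N (h *: v + x - x) := hv _ fK.
  by apply: filterS => h; rewrite addrK.
move=> H; rewrite near_withinE; apply: filterS H => h /= Nh h0.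
by rewrite NZ normfV ler_pdivrMl ?normr_gt0// mulrCA -NZ.
Qed.

(** Near an interior point the Lipschitz bound holds on a full neighbourhood and controls the
    differential there; the bound survives the limit towards [x]. *)
Lemma norm_deriv_on_le (R : realType) (d : nat) (N : 'rV[R]_d -> R)
    (Omega : set 'rV[R]_d) (f : 'rV[R]_d -> 'rV[R]_d) (K : R) :
  is_norm N -> dense_interior Omega -> 0 <= K ->
  (forall x y, Omega x -> Omega y -> N (f x - f y) <= K * N (x - y)) ->
  forall x v, Omega x -> N (deriv_on Omega f x v) <= K * N v.
Proof.
move=> hN dO K0 fK x v Ox.
have PF : ProperFilter (within Omega° (nbhs x)).
  by apply: within_nbhs_proper; exact: dO.
apply: norm_lim_le => //; rewrite near_withinE; apply: nearW => y Oy.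
apply: norm_diff_le => //.
by apply: filterS (Oy) => z Oz; apply: fK => //; exact: interior_subset.
Qed.

(** * Operator norms, and the Lipschitz bound for a single map *)

(** If [S] is empty or unbounded, [sup] takes its default value 0. *)
Lemma sup_nonneg_ge0 (R : realType) (S : set R) :
  (forall r, S r -> 0 <= r) -> 0 <= sup S.
Proof.
move=> S_ge0; have [hS|nhS] := pselect (has_sup S); last by rewrite sup_out.
have [[r Sr] _] := hS.
by apply: (le_trans (S_ge0 _ Sr)); exact: sup_upper_bound.
Qed.

Lemma op_norm_le (R : realType) (V : lmodType R) (N : V -> R) (A : V -> V)
    (K : R) :
  is_norm N -> 0 <= K -> (forall v, N (A v) <= K * N v) -> op_norm N A <= K.
Proof.
move=> hN K0 AK; apply: ge_sup.
  by exists (N (A 0)); exists 0 => //=; rewrite is_norm0.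
move=> _ [v /= v1 <-]; apply: (le_trans (AK v)).
by rewrite -[leRHS]mulr1 ler_wpM2l.
Qed.

(** Rescale [v] to [N]-norm 1. The bound by [K] makes the set under [sup] bounded, so that its
    supremum is a genuine upper bound. *)
Lemma le_op_norm (R : realType) (V : lmodType R) (N : V -> R)
    (A : {linear V -> V}) (K : R) (v : V) :
  is_norm N -> (forall v, N (A v) <= K * N v) -> N (A v) <= op_norm N A * N v.
Proof.
move=> hN AK; have [_ NZ N0] := hN.
have [/N0 ->|v0] := eqVneq (N v) 0.
  by rewrite linear0 is_norm0// mulr0.
have Nv : 0 < N v by rewrite lt_neqAle eq_sym v0 is_norm_ge0.
rewrite -ler_pdivrMr// mulrC -[(N v)^-1]gtr0_norm ?invr_gt0// -NZ -linearZ.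
apply: ub_le_sup.
  (* The sign of [K] is unknown, and [N w <= 1] can only be multiplied by a nonnegative factor. *)
  exists `|K| => _ [w /= w1 <-]; apply: (le_trans (AK w)).
  apply: (@le_trans _ _ (`|K| * N w)).
    by rewrite ler_wpM2r ?is_norm_ge0// ler_norm.
  by rewrite -[leRHS]mulr1 ler_wpM2l.
exists ((N v)^-1 *: v) => //=.
by rewrite NZ gtr0_norm ?invr_gt0// mulVf.
Qed.

Lemma is_norm_bounded_on_compact (R : realType) (d : nat) (N : 'rV[R]_d -> R)
    (Omega : set 'rV[R]_d) (u : 'rV[R]_d -> 'rV[R]_d) :
  is_norm N -> compact Omega ->
  (forall x, Omega x -> {for x, continuous u}) ->
  exists M, forall x, Omega x -> N (u x) <= M.
Proof.
move=> hN cO cu.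
have [ne|ne] := pselect (Omega !=set0); last first.
  by exists 0 => x Ox; exfalso; apply: ne; exists x.
have cNu : {within Omega, continuous (N \o u)}.
  apply: continuous_in_subspaceT => x; rewrite inE => Ox.
  apply: continuous_comp; first exact: cu.
  exact: is_norm_continuous.
have [c _ cmax] := EVT_max_rV ne cO cNu.
by exists (N (u c)) => x Ox; apply: cmax; rewrite inE.
Qed.

Lemma convex_set_segment (R : realType) (V : lmodType R) (Omega : set V)
    (x y : V) (t : R) :
  convex_set (M := V) Omega -> Omega x -> Omega y -> 0 <= t <= 1 ->
  Omega (y + t *: (x - y)).
Proof.
move=> cO Ox Oy /andP[t0 t1].
have := cO x y (Itv01 t0 t1); rewrite !inE => /(_ Ox Oy).
rewrite [conv _ _ _](_ : _ = t *: x + (1 - t) *: y)//.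
by rewrite scalerBr scalerBl scale1r [y + _]addrCA.
Qed.

(** The derivative term in the maximum defining [Ck_norm] at order 1. *)
Definition sup_op_norm (R : realType) (V : normedModType R) (N : V -> R)
    (Omega : set V) (f : V -> V) : R :=
  sup [set op_norm N (deriv_on Omega f x) | x in Omega].

Lemma op_norm_ge0 (R : realType) (V : lmodType R) (N : V -> R) (A : V -> V) :
  is_norm N -> 0 <= op_norm N A.
Proof.
by move=> hN; apply: sup_nonneg_ge0 => _ [v _ <-]; exact: is_norm_ge0.
Qed.

Lemma sup_op_norm_ge0 (R : realType) (V : normedModType R) (N : V -> R)
    (Omega : set V) (f : V -> V) :
  is_norm N -> 0 <= sup_op_norm N Omega f.
Proof.
by move=> hN; apply: sup_nonneg_ge0 => _ [x _ <-]; exact: op_norm_ge0.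
Qed.

(** The mean value inequality is applied along the segment from [y] to [x], which convexity keeps in
    [Omega]. Compactness makes the supremum of the operator norms finite. *)
Lemma C1_on_lipschitz (R : realType) (d : nat) (Omega : set 'rV[R]_d)
    (N : 'rV[R]_d -> R) (f : 'rV[R]_d -> 'rV[R]_d) :
  compact Omega -> convex_set (M := 'rV[R]_d) Omega -> dense_interior Omega ->
  is_norm N -> C1_on Omega f ->
  forall x y, Omega x -> Omega y ->
    N (f x - f y) <= sup_op_norm N Omega f * N (x - y).
Proof.
move=> cO vO dO hN sf x y Ox Oy; have [_ NZ _] := hN.
have [g [fg dg cdg dfg]] := C1_on_deriv dO sf.
(* On the compact [Omega] each ['d g z 'e_i] is bounded in [z]; expanding [v] in the basis and
   comparing the max norm with [N] gives one constant for all [z] and [v]. *)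
have [M dgM] : exists M, forall z v, Omega z -> N ('d g z v) <= M * N v.
  have [C C0 NC] := norm_le_is_norm hN.
  have /choice[m mP] : forall i : 'I_d,
      exists m, forall z, Omega z -> N ('d g z 'e_i) <= m.
    by move=> i; apply: is_norm_bounded_on_compact => // z Oz; exact: cdg.
  exists ((\sum_i `|m i|) * C) => z v Oz.
  apply: (le_trans (norm_linear_le _ v hN)); rewrite -mulrA.
  apply: ler_pM => //; first by apply: sumr_ge0 => i _; exact: is_norm_ge0.
  by apply: ler_sum => i _; apply: (le_trans (mP i z Oz)); exact: ler_norm.
have dgK z v : Omega z -> N ('d g z v) <= sup_op_norm N Omega f * N v.
  move=> Oz; apply: (le_trans (le_op_norm v hN (fun w => dgM z w Oz))).
  rewrite ler_wpM2r ?is_norm_ge0//; apply: ub_le_sup.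
    exists `|M| => _ [w Ow <-]; rewrite dfg//; apply: op_norm_le => // v'.
    apply: (le_trans (dgM w v' Ow)).
    by rewrite ler_wpM2r ?is_norm_ge0// ler_norm.
  by exists z => //; rewrite dfg.
(* The path uses [g], which is differentiable at every point of [Omega], so [h] has two-sided
   derivatives even at the endpoints. *)
rewrite !fg//; pose h (t : R) := g (y + t *: (x - y)).
have -> : g x - g y = h 1 - h 0 by rewrite /h scale1r scale0r addr0 subrKC.
apply: mean_value_inequality => // t t01.
have Ot := convex_set_segment vO Ox Oy t01.
have dl : is_diff t (fun s : R => y + s *: (x - y)) (fun s => s *: (x - y)).
  have := is_diffD (is_diff_cst y t) (is_diff_scalel t (x - y)).
  by rewrite add0r.
have dgt : is_diff (y + t *: (x - y)) g ('d g (y + t *: (x - y))).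
  exact/differentiableP/dg.
have dh := is_diff_comp dl dgt.
split; first by apply/derivable1_diffP; exact: (@ex_diff _ _ _ _ _ _ _ dh).
rewrite deriveE; last exact: (@ex_diff _ _ _ _ _ _ _ dh).
have -> : 'd h t 1 = 'd g (y + t *: (x - y)) (x - y).
  have /(congr1 (@^~ (1 : R))) := @diff_val _ _ _ _ _ _ _ dh.
  by rewrite /= scale1r.
exact: dgK.
Qed.

(** Nonnegativity of [K] covers the empty set, whose [sup] is 0; this case arises for empty
    [Omega]. *)
Lemma sup_le_nonneg (R : realType) (S : set R) (K : R) :
  0 <= K -> (forall r, S r -> r <= K) -> sup S <= K.
Proof.
move=> K0 SK; have [ne|/set0P/negP/negPn/eqP ->] := pselect (S !=set0).
  exact: ge_sup.
by rewrite sup0.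
Qed.

(** * Maps in [Diff_boundary_sub_id], their sup norms and Lipschitz constants *)

Lemma Diff_boundary_sub_id_C1 (R : realType) (V : normedModType R)
    (Omega : set V) (f : V -> V) :
  Diff_boundary_sub_id Omega f -> C1_on Omega f.
Proof.
move=> [phi [[_ [U [g [oU OU Ckg phig]]] _] _] fphi].
have [dg cg] := Ckg 1%N.
exists U, (g - id); split=> //; last first.
  by move=> x Ox; rewrite fphi// phig.
have dgid x : U x -> is_diff x (g - id) (('d g x : V -> V) - id).
  by move=> Ux; exact: is_diffB (differentiableP (dg x Ux)) (is_diff_id x).
have D v : forall x, U x -> 'D_v (g - id) x = 'D_v g x - v.
  move=> x Ux; rewrite deriveE;
    last exact: (@ex_diff _ _ _ _ _ _ _ (dgid x Ux)).
  by rewrite (@diff_val _ _ _ _ _ _ _ (dgid x Ux)) deriveE//; exact: dg.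
split=> [x Ux|v x Ux]; first exact: (@ex_diff _ _ _ _ _ _ _ (dgid x Ux)).
rewrite /prop_for /continuous_at D//.
apply: (@cvg_trans _ ('D_v g y - v @[y --> x])).
  apply: near_eq_cvg; apply: filterS (open_nbhs_nbhs (conj oU Ux)) => y Uy.
  by rewrite D.
by apply: cvgB; [exact: cg|exact: cvg_cst].
Qed.

Lemma Diff_boundary_sub_id_stable (R : realType) (V : normedModType R)
    (Omega : set V) (f : V -> V) (x : V) :
  Diff_boundary_sub_id Omega f -> Omega x -> Omega (x + f x).
Proof.
move=> [phi [[[phiO _ _] _ _] _] fphi] Ox; rewrite fphi// subrKC.
exact: phiO.
Qed.

Lemma le_sup_norm (R : realType) (d : nat) (N : 'rV[R]_d -> R)
    (Omega : set 'rV[R]_d) (f : 'rV[R]_d -> 'rV[R]_d) (x : 'rV[R]_d) :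
  is_norm N -> compact Omega -> C1_on Omega f -> Omega x ->
  N (f x) <= sup_norm N Omega f.
Proof.
move=> hN cO [U [g [_ OU [dg _] fg]]] Ox; apply: ub_le_sup; last by exists x.
have cg y : Omega y -> {for y, continuous g}.
  by move=> Oy; exact/differentiable_continuous/dg/OU.
have [M gM] := is_norm_bounded_on_compact hN cO cg.
by exists M => _ [y Oy <-]; rewrite fg//; exact: gM.
Qed.

Lemma sup_norm_ge0 (R : realType) (V : normedModType R) (N : V -> R)
    (Omega : set V) (f : V -> V) :
  is_norm N -> 0 <= sup_norm N Omega f.
Proof.
by move=> hN; apply: sup_nonneg_ge0 => _ [x _ <-]; exact: is_norm_ge0.
Qed.

Lemma Lip_le (R : realType) (V : normedModType R) (N : V -> R)
    (Omega : set V) (f : V -> V) (K : R) :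
  0 <= K ->
  (forall x y, Omega x -> Omega y -> N (f x - f y) <= K * N (x - y)) ->
  Lip N Omega f <= K.
Proof. by move=> K0 fK; apply: ge_inf => //; exists 0 => k []. Qed.

Lemma Lip_ge0 (R : realType) (V : normedModType R) (N : V -> R)
    (Omega : set V) (f : V -> V) : 0 <= Lip N Omega f.
Proof.
rewrite /Lip; set S := [set K | _].
have [ne|/set0P/negP/negPn/eqP ->] := pselect (S !=set0); last by rewrite inf0.
by apply: lb_le_inf => // k [].
Qed.

(** The infimum is attained: for [x] and [y] distinct, the quotient of [N (f x - f y)] by
    [N (x - y)] is a lower bound of all Lipschitz constants. The given [K] shows that there is one,
    so [inf] is not the default 0. *)
Lemma Lip_lipschitz (R : realType) (V : normedModType R) (N : V -> R)
    (Omega : set V) (f : V -> V) (K : R) :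
  is_norm N -> 0 <= K ->
  (forall x y, Omega x -> Omega y -> N (f x - f y) <= K * N (x - y)) ->
  forall x y, Omega x -> Omega y -> N (f x - f y) <= Lip N Omega f * N (x - y).
Proof.
move=> hN K0 fK x y Ox Oy; have [_ _ N0] := hN.
have [/N0/eqP|xy] := eqVneq (N (x - y)) 0.
  by rewrite subr_eq0 => /eqP ->; rewrite !subrr is_norm0// mulr0.
have Nxy : 0 < N (x - y) by rewrite lt_neqAle eq_sym xy is_norm_ge0.
rewrite -ler_pdivrMr//; apply: lb_le_inf; first by exists K.
by move=> k [k0 fk]; rewrite ler_pdivrMr//; exact: fk.
Qed.

(** * Compositions of perturbations of the identity *)

(** [rev_ord] puts the largest index at the head of the big operator, so splitting off the head
    exposes the outermost map. This drives the inductions on the number of maps. *)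
Lemma compose_all_recr (T : Type) (n : nat) (g : 'I_n.+1 -> T -> T) :
  compose_all g =
    g ord_max \o compose_all (fun j => g (widen_ord (leqnSn n) j)).
Proof.
rewrite /compose_all big_ord_recl.
have -> : rev_ord ord0 = ord_max :> 'I_n.+1 by apply: val_inj; rewrite /= subn1.
congr (_ \o _); apply: eq_bigr => j _; congr g; apply: val_inj.
by rewrite /= subSS.
Qed.

Lemma compose_all_stable (T : Type) (n : nat) (g : 'I_n -> T -> T)
    (A : set T) :
  (forall j x, A x -> A (g j x)) -> forall x, A x -> A (compose_all g x).
Proof.
elim: n g => [|n IHn] g gA x Ax; first by rewrite /compose_all big_ord0.
by rewrite compose_all_recr; apply/gA/IHn => // j y; exact: gA.
Qed.

Lemma compose_all_sub_id_le (R : realType) (V : lmodType R) (N : V -> R)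
    (A : set V) (n : nat) (f : 'I_n -> V -> V) (M : 'I_n -> R) :
  is_norm N -> (forall j x, A x -> A (x + f j x)) ->
  (forall j x, A x -> N (f j x) <= M j) ->
  forall x, A x -> N (compose_all (fun j y => y + f j y) x - x) <= \sum_j M j.
Proof.
move=> hN; have [ND _ _] := hN.
elim: n f M => [|n IHn] f M fA fM x Ax.
  by rewrite /compose_all !big_ord0 subrr is_norm0.
(* Regrouping leaves the partial displacement plus the last [f], evaluated at a point that is still
   in [A]. *)
rewrite compose_all_recr big_ord_recr /= addrAC.
apply: (le_trans (ND _ _)); apply: lerD.
  by apply: IHn => // j y Ay; [exact: fA|exact: fM].
by apply: fM; apply: compose_all_stable => // j y Ay; exact: fA.
Qed.

(** If the first [n] maps give displacement constant [P - 1], their composite has constant [P], and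
    the last map [f] adds [K * P]; the sum [(P - 1) + K * P] is [P * (1 + K) - 1]. *)
Lemma compose_all_sub_id_lipschitz (R : realType) (V : lmodType R) (N : V -> R)
    (A : set V) (n : nat) (f : 'I_n -> V -> V) (K : 'I_n -> R) :
  is_norm N -> (forall j x, A x -> A (x + f j x)) -> (forall j, 0 <= K j) ->
  (forall j x y, A x -> A y -> N (f j x - f j y) <= K j * N (x - y)) ->
  let Phi x := compose_all (fun j y => y + f j y) x - x in
  forall x y, A x -> A y ->
    N (Phi x - Phi y) <= (\prod_j (1 + K j) - 1) * N (x - y).
Proof.
move=> hN; have [ND _ _] := hN.
elim: n f K => [|n IHn] f K fA K0 fK Phi x y Ax Ay.
  by rewrite /Phi /compose_all !big_ord0 !subrr mul0r is_norm0.
rewrite /Phi compose_all_recr big_ord_recr /=.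
set w := fun j => widen_ord (leqnSn n) j.
set c := compose_all _.
have cA z : A z -> A (c z).
  by apply: compose_all_stable => j u; exact: fA.
set P := \prod_(i < n) _.
have IH : N ((c x - x) - (c y - y)) <= (P - 1) * N (x - y).
  by apply: (IHn (fun j => f (w j)) (fun j => K (w j))) => // *;
    [exact: fA|exact: fK].
have fc := fK ord_max _ _ (cA x Ax) (cA y Ay).
have cxy : N (c x - c y) <= P * N (x - y).
  have -> : c x - c y = ((c x - x) - (c y - y)) + (x - y).
    by rewrite -{1}(subrK x (c x)) -{1}(subrK y (c y)) opprD addrACA.
  by apply: (le_trans (ND _ _)); lra.
have -> : c x + f ord_max (c x) - x - (c y + f ord_max (c y) - y) =
    ((c x - x) - (c y - y)) + (f ord_max (c x) - f ord_max (c y)).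
  by rewrite [c x + _ - x]addrAC [c y + _ - y]addrAC opprD addrACA.
apply: (le_trans (ND _ _)).
have := ler_wpM2l (K0 ord_max) cxy; lra.
Qed.

(** * Exponential estimates and the final assembly *)

Lemma prod_1D_le_expR (R : realType) (n : nat) (a : 'I_n -> R) :
  (forall j, 0 <= a j) -> \prod_j (1 + a j) <= expR (\sum_j a j).
Proof.
move=> a0; rewrite expR_sum; apply: ler_prod => j _.
by rewrite expR_ge1Dx andbT addr_ge0.
Qed.

(** Multiply [1 - s <= expR (- s)] by [expR s]. *)
Lemma expR_sub1_le (R : realType) (s : R) : expR s - 1 <= expR s * s.
Proof.
have := expR_ge1Dx (- s); rewrite -(ler_pM2l (expR_gt0 s)) expRxMexpNx_1.
by rewrite mulrDr mulr1 mulrN; lra.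
Qed.

Unset Implicit Arguments.
Set Strict Implicit.

Theorem mainTheorem4 (R : realType) (d : nat) (Omega : set 'rV[R]_d)
    (N : 'rV[R]_d -> R)
    (Omega_compact : compact Omega)
    (Omega_convex : convex_set (M := 'rV[R]_d) Omega)
    (Omega_dense_interior : dense_interior Omega)
    (N_norm : is_norm N)
    (L : nat) (f : 'I_L -> 'rV[R]_d -> 'rV[R]_d)
    (fV : forall j, Diff_boundary_sub_id Omega (f j)) :
  let Phi := fun x : 'rV[R]_d =>
    compose_all (fun j (y : 'rV[R]_d) => y + f j y) x - x in
  [/\ (forall k : nat, (k <= 1)%N ->
        Ck_norm N Omega k Phi <=
          expR (k%:R * \sum_(j < L) Ck_norm N Omega k (f j)) *
          \sum_(j < L) Ck_norm N Omega k (f j)),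
      sup_norm N Omega Phi <= \sum_(j < L) sup_norm N Omega (f j) &
      [/\ Lip N Omega Phi <= \prod_(j < L) (1 + Lip N Omega (f j)) - 1,
          \prod_(j < L) (1 + Lip N Omega (f j)) - 1 <=
            expR (\sum_(j < L) Lip N Omega (f j)) - 1 &
          expR (\sum_(j < L) Lip N Omega (f j)) - 1 <=
            expR (\sum_(j < L) Lip N Omega (f j)) *
            \sum_(j < L) Lip N Omega (f j)]].
Proof.
move=> Phi.
have fC1 j : C1_on Omega (f j) := Diff_boundary_sub_id_C1 (fV j).
have fO j x : Omega x -> Omega (x + f j x).
  exact: Diff_boundary_sub_id_stable (fV j).
have fLip j := C1_on_lipschitz Omega_compact Omega_convex Omega_dense_interior
  N_norm (fC1 j).
have Lip_sup j : Lip N Omega (f j) <= sup_op_norm N Omega (f j).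
  by apply: Lip_le (fLip j); exact: sup_op_norm_ge0.
have Lip0 j : 0 <= Lip N Omega (f j) by exact: Lip_ge0.
have Phi_sup : sup_norm N Omega Phi <= \sum_(j < L) sup_norm N Omega (f j).
  apply: sup_le_nonneg => [|_ [x Ox <-]].
    by apply: sumr_ge0 => j _; exact: sup_norm_ge0.
  apply: (compose_all_sub_id_le N_norm fO) => // j y Oy.
  exact: le_sup_norm.
pose Q := \prod_(j < L) (1 + Lip N Omega (f j)).
have Phi_lip : forall x y, Omega x -> Omega y ->
    N (Phi x - Phi y) <= (Q - 1) * N (x - y).
  (* [fLip] supplies a Lipschitz constant for each [f j], so the infimum [Lip] is itself one and can
     serve as [K j]. *)
  apply: (compose_all_sub_id_lipschitz N_norm fO) => // j x y Ox Oy.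
  apply: (Lip_lipschitz N_norm _ (fLip j)) => //.
  exact: sup_op_norm_ge0.
(* Nonnegativity admits [Q - 1] as a constant in [Lip_le] and as a bound on operator norms. *)
have Q1 : 0 <= Q - 1.
  rewrite subr_ge0; apply: (big_ind (fun r => 1 <= r)) => // [a b|j _].
    exact: mulr_ege1.
  by rewrite lerDl.
have Q_exp : Q <= expR (\sum_(j < L) Lip N Omega (f j)).
  exact: prod_1D_le_expR.
split=> //; last first.
  by split; [exact: Lip_le|rewrite lerD2r|exact: expR_sub1_le].
(* At order 0 the exponential factor is 1 and the claim is the sup norm bound. *)
move=> [|[|//]] _ /=; first by rewrite mul0r expR0 mul1r.
rewrite mul1r; set S := \sum_(j < L) _.
pose T := \sum_(j < L) Lip N Omega (f j).
have T0 : 0 <= T by apply: sumr_ge0.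
have TS : T <= S.
  by apply: ler_sum => j _; rewrite le_max Lip_sup orbT.
have S0 : 0 <= S := le_trans T0 TS.
have supS : \sum_(j < L) sup_norm N Omega (f j) <= S.
  by apply: ler_sum => j _; rewrite le_max lexx.
rewrite ge_max; apply/andP; split.
  apply: (le_trans Phi_sup); apply: (le_trans supS).
  by rewrite ler_peMl// -expR0 ler_expR.
(* The derivative term follows the chain [Q - 1 <= expR T - 1 <= expR T * T <= expR S * S]. *)
apply: (@le_trans _ _ (Q - 1)).
  apply: sup_le_nonneg => // _ [x Ox <-]; apply: op_norm_le => // v.
  exact: norm_deriv_on_le.
apply: (@le_trans _ _ (expR T - 1)); first by rewrite lerD2r.
apply: (le_trans (expR_sub1_le T)).
by apply: ler_pM => //; rewrite ?expR_ge0 ?ler_expR.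
Qed.
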